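(* Set automata and $\mathrm{EMSO}^2[\Sigma,<,+1,\sim,\oplus 1,\mathcal{F}]$ are expressively equivalent: a data language is recognised by some set automaton if and only if it is the set of data words satisfying some formula of $\mathrm{EMSO}^2[\Sigma,<,+1,\sim,\oplus 1,\mathcal{F}]$.
   Context: Fix an infinite set $\mathcal{D}$ of data values. A data word $(a_1,d_1)\cdots(a_n,d_n)$ over $\Sigma$ is a structure on positions $\{1,\dots,n\}$ with $a(x)$ ($a\in\Sigma$), $<$, $y=x+1$, $x\sim y$ iff same data value, and class successor $y=x\oplus 1$ iff $x<y$, $x\sim y$ and no position strictly between has the same data value. For a regular language $L$ over $\Gamma$, the regular predicate $L(x,y)$ holds at $(i,j)$ iff $i<j$ and the word of $\Gamma$-labels strictly between $i$ and $j$ is in $L$. $\mathrm{EMSO}^2[\Sigma,<,+1,\sim,\oplus 1,\mathcal{F}]$ consists of formulas $\exists X_1\cdots\exists X_n\,\varphi$ with monadic set variables $X_i$ and $\varphi$ a first-order formula in two variables $x,y$ over atoms $a(x)$, $X_i(x)$, $x=y$, $x<y$, $y=x+1$, $x\sim y$, $y=x\oplus 1$, and regular predicates $L(x,y)$ with $L$ regular over $\Gamma=\Sigma\times 2^{\{X_1,\dots,X_n\}}$. Set automata: for finite $Y$, $\mathbbm{2}^Y$ is $\{0,1\}$-vectors indexed by $Y$, $\mathbf{R}_Y$ the binary relations on $Y$. A set automaton $(Q,Y,\Sigma,\Delta,I,F,C)$ has finite states $Q$, set names $Y$, $\Delta\subseteq Q\times\Sigma\times\mathbbm{2}^Y\times\mathbf{R}_Y\times\mathbbm{2}^Y\times\mathbbm{2}^Y\times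 Q$, $I,F\subseteq Q$, $C\subseteq\mathbbm{2}^Y$. Configurations $(q,(X_y)_{y\in Y})$, $X_y\subseteq\mathcal{D}$; initial if $q\in I$, all empty. On $(a,d)$, transition $(p,\ell,\bar z,\rho,\bar u,\bar v,p')$ applies iff $p=q$, $\ell=a$, $\bar z$ is the characteristic vector of $d$; it yields $(p',\bar X'')$ with $X'_y=\bigcup_{(x,y)\in\rho}X_x$, $X''_y=(X'_y\cup U_y)\setminus V_y$, $U_y=\{d\}$ iff $u_y=1$, $V_y=\{d\}$ iff $v_y=1$ (else $\emptyset$). Accepting: $q\in F$ and every data value present in some $X_y$ has characteristic vector in $C$; the language is the set of data words with a run from an initial to an accepting configuration. *)

(* Defs.v *)
From mathcomp Require Import all_boot.
From mathcomp Require Import boolp classical_sets cardinality.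

Set Implicit Arguments.
Unset Strict Implicit.
Unset Printing Implicit Defensive.

Local Open Scope classical_set_scope.

Definition data_word (Sigma : finType) (D : Type) := seq (Sigma * D).

Definition data_language (Sigma : finType) (D : Type) :=
  set (data_word Sigma D).

Definition ext_letter (Sigma : finType) (n : nat) : finType :=
  (Sigma * {set 'I_n})%type.

(* The factor of [s] strictly between positions [i] and [j]. *)
Definition between T (s : seq T) (i j : nat) : seq T := drop i.+1 (take j s).

(* Positions are numbered from 0: the domain of the structure of [w] is
   {i : nat | i < size w}, and [has_letter], [has_datum], [same_data],
   [succ_pos] and [class_succ] are false at numbers that are not positions. *)
Section Structure.
Variables (Sigma : finType) (D : Type).
Implicit Types (w : data_word Sigma D) (i j k : nat).

Definition has_letter w (a : Sigma) i : Prop :=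
  exists d, onth w i = Some (a, d).

Definition has_datum w (d : D) i : Prop :=
  exists a, onth w i = Some (a, d).

Definition same_data w i j : Prop :=
  exists2 d, has_datum w d i & has_datum w d j.

Definition succ_pos w i j : Prop := j < size w /\ j = i.+1.

Definition class_succ w i j : Prop :=
  [/\ i < j, same_data w i j & forall k, i < k < j -> ~ same_data w i k].

(* The word over [ext_letter Sigma n] obtained from [w] by dropping the data
   values and recording, at each position, which sets [X k] it belongs to. *)
Definition ext_word n (X : 'I_n -> set nat) w : seq (ext_letter Sigma n) :=
  [seq (p.1.1, [set k | p.2 \in X k]%SET) | p <- zip w (iota 0 (size w))].

End Structure.

Record dfa (Gamma : finType) := DFA {
  dfa_state : finType;
  dfa_init : dfa_state;
  dfa_trans : dfa_state -> Gamma -> dfa_state;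
  dfa_final : {set dfa_state} }.

Definition dfa_accepts (Gamma : finType) (A : dfa Gamma) (s : seq Gamma) : bool :=
  foldl (@dfa_trans _ A) (dfa_init A) s \in dfa_final A.

Definition regular (Gamma : finType) (L : set (seq Gamma)) : Prop :=
  exists A : dfa Gamma, forall s, L s <-> dfa_accepts A s.

Inductive var := vx | vy.

Definition eqv (u v : var) : bool :=
  match u, v with vx, vx | vy, vy => true | _, _ => false end.

Inductive fo2 (Sigma : finType) (n : nat) : Type :=
| FLetter of Sigma & var
| FSet of 'I_n & var
| FEq of var & var
| FLt of var & var
| FSucc of var & var       (* FSucc u v is  v = u + 1 *)
| FSim of var & var
| FClassSucc of var & var  (* FClassSucc u v is  v = u (+) 1 *)
| FReg (L : set (seq (ext_letter Sigma n))) of regular L & var & var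
| FNot of fo2 Sigma n
| FAnd of fo2 Sigma n & fo2 Sigma n
| FOr of fo2 Sigma n & fo2 Sigma n
| FEx of var & fo2 Sigma n
| FAll of var & fo2 Sigma n.

Fixpoint free (Sigma : finType) (n : nat) (phi : fo2 Sigma n) (t : var) : bool :=
  match phi with
  | FLetter _ u | FSet _ u => eqv t u
  | FEq u v | FLt u v | FSucc u v | FSim u v | FClassSucc u v
  | FReg _ _ u v => eqv t u || eqv t v
  | FNot f => free f t
  | FAnd f g | FOr f g => free f t || free g t
  | FEx u f | FAll u f => ~~ eqv t u && free f t
  end.

Definition update (e : var -> nat) (u : var) (i : nat) : var -> nat :=
  fun t => if eqv t u then i else e t.

Fixpoint sat (Sigma : finType) (D : Type) (n : nat) (w : data_word Sigma D)
    (X : 'I_n -> set nat) (e : var -> nat) (phi : fo2 Sigma n) : Prop :=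
  match phi with
  | FLetter a u => has_letter w a (e u)
  | FSet k u => X k (e u)
  | FEq u v => e u = e v
  | FLt u v => e u < e v
  | FSucc u v => succ_pos w (e u) (e v)
  | FSim u v => same_data w (e u) (e v)
  | FClassSucc u v => class_succ w (e u) (e v)
  | FReg L _ u v => e u < e v /\ L (between (ext_word X w) (e u) (e v))
  | FNot f => ~ sat w X e f
  | FAnd f g => sat w X e f /\ sat w X e g
  | FOr f g => sat w X e f \/ sat w X e g
  | FEx u f => exists2 i, i < size w & sat w X (update e u i) f
  | FAll u f => forall i, i < size w -> sat w X (update e u i) f
  end.

(* [exists X_0 ... X_(n-1), matrix], where [matrix] is closed as regards its
   first-order variables. *)
Record emso2 (Sigma : finType) := EMSO2 {
  nb_sets : nat;
  matrix : fo2 Sigma nb_sets;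
  matrix_closed : forall t, ~~ free matrix t }.

(* The initial valuation is irrelevant because the matrix is closed; using
   numbers instead of positions makes sense of the empty data word too. *)
Definition emso2_language (Sigma : finType) (D : Type) (phi : emso2 Sigma) :
    data_language Sigma D :=
  [set w | exists X : 'I_(nb_sets phi) -> set nat,
     (forall k, X k `<=` [set i | i < size w]) /\
     sat w X (fun=> 0) (matrix phi)].

Definition bvec (Y : finType) : finType := {ffun Y -> bool}.

Definition brel (Y : finType) : finType := {set Y * Y}.

Record set_automaton (Sigma : finType) := SetAutomaton {
  sa_state : finType;
  sa_name : finType;
  sa_delta : {set sa_state * Sigma * bvec sa_name * brel sa_name *
                  bvec sa_name * bvec sa_name * sa_state};
  sa_init : {set sa_state};
  sa_final : {set sa_state};
  sa_acc : {set bvec sa_name} }.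

Section SetAutomaton.
Variables (Sigma : finType) (D : Type) (A : set_automaton Sigma).
Local Notation Q := (sa_state A).
Local Notation Y := (sa_name A).

Definition config : Type := Q * (Y -> set D).

Definition char_vec (X : Y -> set D) (d : D) : bvec Y :=
  [ffun y => d \in X y].

Definition data_if (b : bool) (d : D) : set D := if b then [set d] else set0.

Definition set_update (rho : brel Y) (u v : bvec Y) (d : D) (X : Y -> set D) :
    Y -> set D :=
  fun y => (\bigcup_(x in [set x | (x, y) \in rho]) X x `|` data_if (u y) d)
             `\` data_if (v y) d.

Definition sa_step (c : config) (s : Sigma * D) (c' : config) : Prop :=
  exists (rho : brel Y) (u v : bvec Y),
    (c.1, s.1, char_vec c.2 s.2, rho, u, v, c'.1) \in sa_delta A /\
    c'.2 = set_update rho u v s.2 c.2.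

Fixpoint sa_run (c : config) (w : data_word Sigma D) (c' : config) : Prop :=
  if w is s :: w' then exists2 c1, sa_step c s c1 & sa_run c1 w' c'
  else c = c'.

Definition initial (c : config) : Prop :=
  c.1 \in sa_init A /\ forall y, c.2 y = set0.

Definition accepting (c : config) : Prop :=
  c.1 \in sa_final A /\
  forall d, (exists y, c.2 y d) -> char_vec c.2 d \in sa_acc A.

Definition sa_language : data_language Sigma D :=
  [set w | exists c c', [/\ initial c, sa_run c w c' & accepting c']].

End SetAutomaton.

(* Main.v *)
Require Import Defs.
From mathcomp Require Import all_boot.
From mathcomp Require Import boolp classical_sets cardinality.

(* A set automaton is a class automaton: guess a relabelling of the data word and
   require that a finite automaton accepts, for every datum d, the word in which
   the positions carrying d are marked.  The names serve to store, for each datum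
   already seen, the state of that automaton, and the control state serves all
   the unseen data.

   From logic to automata, guess at every position the truth values of the
   quantified subformulas.  Whether the guesses at the positions carrying d are
   correct is a regular property of the word marked with d, since x ~ y then
   means that y is marked too; hence a class automaton can check them.

   From automata to logic, guess the transition taken at every position.  The
   characteristic vector of a datum is determined at its first occurrence, and a
   regular predicate follows it from an occurrence to the class successor, or from
   the last occurrence to the end of the word. *)

Set Implicit Arguments.
Unset Strict Implicit.
Unset Printing Implicit Defensive.

Local Open Scope classical_set_scope.

(** * Closure properties of regular languages *)

Section RegularLanguages.
Implicit Types Gamma : finType.

Lemma eq_regular Gamma (K L : set (seq Gamma)) :
  (forall s, K s <-> L s) -> regular K -> regular L.
Proof. by move=> KL [A AK]; exists A => s; rewrite -KL. Qed.

Lemma regularC Gamma (L : set (seq Gamma)) :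
  regular L -> regular (fun s => ~ L s).
Proof.
case=> A AL; exists (DFA (dfa_init A) (@dfa_trans _ A) (~: dfa_final A)%SET) => s.
rewrite /dfa_accepts /= inE; split=> [nLs|/negP nLs /AL //].
by apply/negP => /AL.
Qed.

Lemma regularI Gamma (K L : set (seq Gamma)) :
  regular K -> regular L -> regular (fun s => K s /\ L s).
Proof.
move=> [A AK] [B BL].
pose step (q : dfa_state A * dfa_state B) a :=
  (dfa_trans q.1 a, dfa_trans q.2 a).
exists (DFA (dfa_init A, dfa_init B) step (finset.setX (dfa_final A) (dfa_final B))) => s.
have stepE : forall q, foldl step q s =
    (foldl (@dfa_trans _ A) q.1 s, foldl (@dfa_trans _ B) q.2 s).
  by elim: s => [|a s IH] [q r] //=; rewrite IH.
rewrite AK BL /dfa_accepts /= stepE inE /=.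
by split=> [[-> ->]|/andP[]].
Qed.

Lemma regular_map Gamma Gamma' (f : Gamma' -> Gamma) (L : set (seq Gamma)) :
  regular L -> regular (fun s => L (map f s)).
Proof.
case=> A AL; exists (DFA (dfa_init A) (fun q a => dfa_trans q (f a)) (dfa_final A)).
move=> s; rewrite AL /dfa_accepts /=.
suff -> : forall q, foldl (@dfa_trans _ A) q (map f s) =
   foldl (fun q a => dfa_trans q (f a)) q s by [].
by elim: s => //= a s IH q; rewrite IH.
Qed.

Lemma regular_all Gamma (p : pred Gamma) : regular (fun s => all p s).
Proof.
exists (DFA true (fun b a => b && p a) [set true]%SET) => s.
rewrite /dfa_accepts /= inE eqb_id.
suff -> : forall b, foldl (fun b a => b && p a) b s = b && all p s by [].
by elim: s => [|a s IH] b /=; rewrite ?andbT ?IH ?andbA.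
Qed.

End RegularLanguages.

(** * Words with marked positions *)

Section Marks.
Variable Gamma : Type.
Implicit Types s : seq Gamma.

Definition blank s : seq (Gamma * bool) := [seq (a, false) | a <- s].

Fixpoint mark s i : seq (Gamma * bool) :=
  match s, i with
  | [::], _ => [::]
  | a :: s', 0 => (a, true) :: blank s'
  | a :: s', i'.+1 => (a, false) :: mark s' i'
  end.

Lemma size_mark s i : size (mark s i) = size s.
Proof. by elim: s i => [|a s IH] [|i] //=; rewrite ?size_map ?IH. Qed.

End Marks.

(** Of two nested marks the one placed last is the outer one; exchanging the two bits gives access
    to the inner one. *)
Lemma mark_swap T (s : seq T) i j :
  mark (mark s j) i = [seq (x.1.1, x.2, x.1.2) | x <- mark (mark s i) j].
Proof.
elim: s i j => [|a s IH] [|i] [|j] //=; congr (_ :: _); rewrite -?IH //.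
- by rewrite /blank -!map_comp; apply: eq_map.
- elim: s j {IH} => [|b s IH] [|j] //=; congr (_ :: _); last exact: IH.
  by rewrite /blank -!map_comp; apply: eq_map.
- elim: s i {IH} => [|b s IH] [|i] //=; congr (_ :: _); last exact: IH.
  by rewrite /blank -!map_comp; apply: eq_map.
Qed.

Lemma all_mark T (s : seq T) i (p : pred (T * bool)) :
  i < size s -> all (fun a => p (a, false)) s ->
  all p (mark s i) = oapp (fun a => p (a, true)) false (onth s i).
Proof.
elim: s i => [|a s IH] [|i] //=.
  by move=> _ /andP[_ ps]; rewrite all_map (eq_all (a2 := fun a => p (a, false))) // ps andbT.
by rewrite ltnS => si /andP[-> ps] /=; rewrite IH.
Qed.

Lemma map_mark T T' (f : T -> T') s i :
  mark (map f s) i = [seq (f x.1, x.2) | x <- mark s i].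
Proof.
elim: s i => [|a s IH] [|i] //=; last by rewrite IH.
by rewrite /blank -!map_comp.
Qed.

Lemma regular_ex_mark (Gamma : finType) (L : set (seq (Gamma * bool))) :
  regular L -> regular (fun s => exists2 i, i < size s & L (mark s i)).
Proof.
case=> A AL.
pose d := @dfa_trans _ A.
(* The second component collects the states of the runs in which the mark has
   already been placed. *)
pose step (q : dfa_state A * {set dfa_state A}) a :=
  (d q.1 (a, false), d q.1 (a, true) |: [set d t (a, false) | t in q.2])%SET.
exists (DFA (dfa_init A, finset.set0) step
          [set q : dfa_state A * {set dfa_state A} |
             [exists t, (t \in q.2) && (t \in dfa_final A)]]%SET) => s.
have stepP : forall q S t, (t \in (foldl step (q, S) s).2) <->
    (exists2 r, r \in S & foldl d r (blank s) = t) \/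
    (exists2 i, i < size s & foldl d q (mark s i) = t).
  elim: s => [|a s IH] q S t /=.
    split=> [tS|[[r rS <-]|[]]] //; by left; exists t.
  rewrite IH; split.
  - move=> [[r]|[i si <-]]; last by right; exists i.+1.
    rewrite !inE => /orP[/eqP->|/imsetP[r' r'S ->]] <-; first by right; exists 0.
    by left; exists r'.
  - move=> [[r rS <-]|[[|i] si <-]]; last by right; exists i.
    + by left; exists (d r (a, false)) => //; rewrite !inE; apply/orP; right; apply/imsetP; exists r.
    + by left; exists (d q (a, true)) => //; rewrite !inE eqxx.
rewrite /dfa_accepts /= inE; split.
- case=> i si /AL As; apply/existsP; exists (foldl d (dfa_init A) (mark s i)).
  by apply/andP; split=> //; apply/stepP; right; exists i.
- case/existsP=> t /andP[/stepP[[r r0 _]|[i si <-]] tF]; first by rewrite inE in r0.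
  by exists i => //; apply/AL.
Qed.

(** * Binary relations on positions recognised by finite automata *)

(** The inner bit marks the first argument and the outer bit the second; the two positions may
    coincide. The language is unconstrained on words that are not marked in this way. *)
Definition reg2 (Gamma : finType) (R : seq Gamma -> nat -> nat -> Prop) : Prop :=
  exists2 L, regular L & forall s i j, i < size s -> j < size s ->
    (R s i j <-> L (mark (mark s i) j)).

Lemma all_takeP T (s : seq T) (p : pred T) j : j <= size s ->
  all p (take j s) <-> forall k, k < j -> oapp p false (onth s k).
Proof.
elim: s j => [|a s IH] [|j] //=; rewrite ltnS => /IH {}IH.
split=> [/andP[pa /IH ps] [|k] //= /ps //|ps].
by apply/andP; split; [apply: (ps 0)|apply/IH => k; apply: (ps k.+1)].
Qed.

Lemma all_betweenP T (s : seq T) (p : pred T) i j : j <= size s ->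
  all p (between s i j) <-> forall k, i < k < j -> oapp p false (onth s k).
Proof.
rewrite /between; elim: s i j => [|a s IH] i [|j] /=.
- by split=> // _ k; rewrite ltn0 andbF.
- by [].
- by split=> // _ k; rewrite ltn0 andbF.
rewrite ltnS => sj; case: i => [|i].
  by rewrite drop0 all_takeP //; split=> [ps [|k] //=|ps k]; [apply: ps|apply: (ps k.+1)].
rewrite IH //; split=> [ps [|k] //=|ps k]; first by rewrite !ltnS; apply: ps.
exact: (ps k.+1).
Qed.

Section RegularRelations.
Variable Gamma : finType.
Implicit Types (R : seq Gamma -> nat -> nat -> Prop).

Lemma eq_reg2 R R' :
  (forall s i j, i < size s -> j < size s -> (R s i j <-> R' s i j)) ->
  reg2 R -> reg2 R'.
Proof.
move=> RR' [L regL RL]; exists L => // s i j si sj.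
by rewrite -RR' // RL.
Qed.

Lemma reg2_not R : reg2 R -> reg2 (fun s i j => ~ R s i j).
Proof.
case=> L regL RL; exists (fun s => ~ L s); first exact: regularC.
by move=> s i j si sj; rewrite RL.
Qed.

Lemma reg2_and R R' :
  reg2 R -> reg2 R' -> reg2 (fun s i j => R s i j /\ R' s i j).
Proof.
case=> L regL RL [L' regL' RL']; exists (fun s => L s /\ L' s).
  exact: regularI.
by move=> s i j si sj; rewrite RL // RL'.
Qed.

Lemma reg2_imply R R' :
  reg2 R -> reg2 R' -> reg2 (fun s i j => R s i j -> R' s i j).
Proof.
move=> rR rR'; have := reg2_not (reg2_and rR (reg2_not rR')).
apply: eq_reg2 => s i j _ _; split=> [H r|H [r nr]]; last exact/nr/H.
by apply: contrapT => nr; apply: H.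
Qed.

Lemma reg2_swap R : reg2 R -> reg2 (fun s i j => R s j i).
Proof.
case=> L regL RL.
exists (fun s => L [seq (x.1.1, x.2, x.1.2) | x <- s]); first exact: regular_map.
by move=> s i j si sj; rewrite RL // mark_swap.
Qed.

Lemma reg2_label (p : pred Gamma) :
  reg2 (fun s i _ => oapp p false (onth s i)).
Proof.
exists (fun s => all (fun x : Gamma * bool * bool => x.1.2 ==> p x.1.1) s).
  exact: regular_all.
move=> s i j si sj; rewrite mark_swap all_map.
rewrite (eq_all (a2 := fun x => x.2 ==> p x.1.1)) // all_mark ?size_mark //; last by elim: (mark _ _) => //.
suff -> : oapp p false (onth s i) = oapp (fun a => p a.1) false (onth (mark s j) i) by [].
elim: s i j si sj => [|a s IH] [|i] [|j] //=; rewrite !ltnS => si sj; last exact: IH.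
by rewrite onth_map; case: (onth s i).
Qed.

Lemma reg2_between (L : set (seq Gamma)) :
  regular L -> reg2 (fun s i j => i < j /\ L (between s i j)).
Proof.
case=> A AL.
(* [None]: no mark seen; [Some (inl q)]: between the marks; [Some (inr b)]:
   verdict [b]. *)
pose S : finType := option (dfa_state A + bool).
pose step (q : S) (x : Gamma * bool * bool) : S :=
  match q with
  | None => if x.2 then Some (inr false)
            else if x.1.2 then Some (inl (dfa_init A)) else None
  | Some (inl q) => if x.2 then Some (inr (q \in dfa_final A))
                    else Some (inl (dfa_trans q x.1.1))
  | Some (inr b) => Some (inr b)
  end.
pose B := DFA (None : S) step [set Some (inr true)]%SET.
exists (fun s => dfa_accepts B s); first by exists B.
move=> s i j si sj; rewrite /dfa_accepts /= inE.
have afterP b t : foldl step (Some (inr b)) t = Some (inr b) by elim: t.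
have betweenP q (t : seq Gamma) k : k < size t ->
    foldl step (Some (inl q)) (mark (blank t) k) =
    Some (inr (foldl (@dfa_trans _ A) q (take k t) \in dfa_final A)).
  elim: t q k => [|a t IH] q [|k] //=; rewrite ?afterP // ltnS => tk.
  by rewrite IH.
elim: s i j si sj => [|a s IH] [|i] [|j] //=; rewrite ?afterP.
- by split=> // -[].
- rewrite ltnS => _ sj; rewrite betweenP //= /between /= drop0.
  have -> : forall b, (Some (inr b) == Some (inr true) :> S) = b by case.
  by split=> [[_ /AL //]|Ls]; split=> //; apply/AL.
- by split=> // -[].
- by rewrite !ltnS => si sj; rewrite -IH.
Qed.

Lemma reg2_lt : reg2 (fun (s : seq Gamma) i j => i < j).
Proof.
apply: (eq_reg2 _ (reg2_between (regular_all predT))) => s i j _ _.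
by split=> [[]|ij] //; split=> //; rewrite all_predT.
Qed.

Lemma regular_ex_ex R : reg2 R ->
  regular (fun s => exists2 i, i < size s & exists2 j, j < size s & R s i j).
Proof.
case=> L regL RL; have := regular_ex_mark (regular_ex_mark regL).
apply: eq_regular => s; split=> -[i si [j sj Rij]]; exists i => //; exists j.
- by move: sj; rewrite size_mark.
- by rewrite RL //; move: sj; rewrite size_mark.
- by rewrite size_mark.
- by rewrite -RL.
Qed.

Lemma regular_all_all R : reg2 R ->
  regular (fun s => forall i j, i < size s -> j < size s -> R s i j).
Proof.
move=> /reg2_not /regular_ex_ex /regularC; apply: eq_regular => s; split.
  move=> H i j si sj; apply: contrapT => nR; apply: H.
  by exists i => //; exists j.
by move=> H [i si [j sj]]; apply; apply: H.
Qed.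

(** The existential quantifier erases the outer mark; the universal one erases the inner mark
    between two complementations. *)
Lemma regular_all_ex R : reg2 R ->
  regular (fun s => forall i, i < size s -> exists2 j, j < size s & R s i j).
Proof.
case=> L regL RL; have := regularC (regular_ex_mark (regularC (regular_ex_mark regL))).
apply: eq_regular => s; split.
  move=> H i si; apply: contrapT => nR; apply: H; exists i => // -[j].
  by rewrite size_mark => sj Lij; apply: nR; exists j => //; rewrite RL.
move=> H [i si]; apply; have [j sj Rij] := H i si.
by exists j; rewrite ?size_mark // -RL.
Qed.

End RegularRelations.

Lemma reg2_map (Gamma Gamma' : finType) (f : Gamma' -> Gamma) R :
  reg2 R -> reg2 (fun s => R (map f s)).
Proof.
case=> L regL RL; exists (fun s => L [seq (f x.1.1, x.1.2, x.2) | x <- s]).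
  exact: (regular_map (fun x => (f x.1.1, x.1.2, x.2))).
by move=> s i j si sj; rewrite RL ?size_map // !map_mark.
Qed.

(** * Data words marked with one class, and advice for relations on positions *)

Section DataWords.
Variable D : Type.

Definition relabel B B' (f : B -> B') (v : seq (B * D)) : seq (B' * D) :=
  [seq (f x.1, x.2) | x <- v].

Definition dmark B (v : seq (B * D)) (d : D) : seq (B * bool) :=
  [seq (x.1, `[< x.2 = d >]) | x <- v].

Lemma dmark_relabel B B' (f : B -> B') v d :
  dmark (relabel f v) d = [seq (f x.1, x.2) | x <- dmark v d].
Proof. by rewrite /dmark /relabel -!map_comp. Qed.

Lemma has_datum_relabel (B B' : finType) (f : B -> B') v d i :
  has_datum (relabel f v) d i <-> has_datum v d i.
Proof.
rewrite /has_datum /relabel onth_map; case: (onth v i) => [[b d']|] /=; last first.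
  by split=> -[].
by split=> -[a [_ <-]]; [exists b|exists (f b)].
Qed.

Lemma has_datum_dmark (B : finType) (v : seq (B * D)) d i :
  has_datum v d i <-> oapp snd false (onth (dmark v d) i).
Proof.
rewrite /has_datum /dmark onth_map; case: (onth v i) => [[b d']|] /=; last first.
  by split=> // -[].
by split=> [[a [_ ->]]|/asboolP->]; [apply/asboolP|exists b].
Qed.

Lemma has_datum_ex (B : finType) (v : seq (B * D)) i :
  i < size v -> exists d, has_datum v d i.
Proof.
by elim: v i => [|[b d] v IH] [|i] //=; [exists d, b|rewrite ltnS => /IH].
Qed.

Lemma has_datum_inj (B : finType) (v : seq (B * D)) d d' i :
  has_datum v d i -> has_datum v d' i -> d = d'.
Proof. by move=> [a e] [a']; rewrite e => -[_ ->]. Qed.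

(** Once one of the two positions carries [d], having the same datum can be read off the word marked
    with [d]. *)
Lemma same_dataE (B : finType) (v : seq (B * D)) d i j :
  has_datum v d i \/ has_datum v d j ->
  (same_data v i j <-> has_datum v d i /\ has_datum v d j).
Proof.
move=> vd; split=> [[d' vi vj]|[vi vj]]; last by exists d.
by case: vd => [/(has_datum_inj vi)<-|/(has_datum_inj vj)<-].
Qed.

(* [Phi] becomes a regular relation on every word marked with the class of one
   of its two arguments, once each position carries some advice in [P] whose
   correctness is a regular property of each marked word. *)
Definition advisable (G : finType) (Phi : seq (G * D) -> nat -> nat -> Prop) :=
  exists (P : finType) (Cor : set (seq (G * P * bool)))
    (R : seq (G * P * bool) -> nat -> nat -> Prop),
  [/\ regular Cor, reg2 R,
      forall v, Cor (blank v),
      forall u, exists2 v, relabel fst v = u & forall d, Cor (dmark v d) &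
      forall v i j d, (forall d, Cor (dmark v d)) -> i < size v -> j < size v ->
        has_datum v d i \/ has_datum v d j ->
        (Phi (relabel fst v) i j <-> R (dmark v d) i j)].

Lemma relabel_bits_ex G P (v : seq (G * P * D)) (b : nat -> bool) :
  exists2 v' : seq (G * (P * bool) * D),
    relabel (fun x => (x.1, x.2.1)) v' = v &
    forall i d, i < size v ->
      oapp (fun x => x.1.2.2) false (onth (dmark v' d) i) = b i.
Proof.
elim: v b => [|[[g p] d] v IH] b; first by exists [::].
have [v' <- bv'] := IH (fun i => b i.+1).
exists ((g, (p, b 0), d) :: v') => //= -[|i] d' //=; rewrite ltnS => vi.
exact: bv'.
Qed.

Section Advisable.
Variable G : finType.
Implicit Types Phi : seq (G * D) -> nat -> nat -> Prop.

Lemma eq_advisable Phi Phi' :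
  (forall u i j, i < size u -> j < size u -> (Phi u i j <-> Phi' u i j)) ->
  advisable Phi -> advisable Phi'.
Proof.
move=> eqPhi [P [Cor [R [rCor rR blk ex RP]]]]; exists P, Cor, R; split=> // v i j d vC vi vj vd.
by rewrite -eqPhi ?size_map //; apply: RP.
Qed.

(** Meant for atoms: they need no advice, so the advice set is [unit] and every word is correct. *)
Lemma advisable_reg2 Phi (R : seq (G * bool) -> nat -> nat -> Prop) : reg2 R ->
  (forall u i j d, i < size u -> j < size u ->
     has_datum u d i \/ has_datum u d j ->
     (Phi u i j <-> R (dmark u d) i j)) ->
  advisable Phi.
Proof.
move=> rR PhiR.
pose f (x : G * unit * bool) := (x.1.1, x.2).
exists unit, (fun=> True), (fun s => R (map f s)); split=> //.
- apply: (eq_regular _ (regular_all predT)) => s; split=> // _.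
  by rewrite all_predT.
- exact: (reg2_map f).
- move=> u; exists (relabel (fun g => (g, tt)) u) => //.
  by rewrite /relabel -map_comp; elim: u => //= -[g d] u {2}<-.
- move=> v i j d _ vi vj vd; rewrite (PhiR _ _ _ d) ?size_map //.
    by rewrite dmark_relabel.
  by rewrite !has_datum_relabel.
Qed.

Lemma advisable_not Phi : advisable Phi -> advisable (fun u i j => ~ Phi u i j).
Proof.
move=> [P [Cor [R [rCor rR blk ex RP]]]].
exists P, Cor, (fun s i j => ~ R s i j); split=> //; first exact: reg2_not.
by move=> v i j d vC vi vj vd; rewrite (RP v i j d).
Qed.

Lemma advisable_swap Phi : advisable Phi -> advisable (fun u i j => Phi u j i).
Proof.
move=> [P [Cor [R [rCor rR blk ex RP]]]].
exists P, Cor, (fun s i j => R s j i); split=> //; first exact: reg2_swap.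
by move=> v i j d vC vi vj vd; apply: RP => //; case: vd; [right|left].
Qed.

Lemma relabel_pair P1 P2 (v1 : seq (G * P1 * D)) (v2 : seq (G * P2 * D)) :
  relabel fst v1 = relabel fst v2 ->
  exists2 v : seq (G * (P1 * P2) * D),
    relabel (fun x => (x.1, x.2.1)) v = v1 & relabel (fun x => (x.1, x.2.2)) v = v2.
Proof.
elim: v1 v2 => [|[[g p] d] v1 IH] [|[[g' p'] d'] v2] //=; first by exists [::].
by case=> <- <- /IH[v <- <-]; exists ((g, (p, p'), d) :: v).
Qed.

(** The advice is paired, and each half is checked and used on its own; two advised versions of the
    same word are zipped by [relabel_pair]. *)
Lemma advisable_and Phi Phi' : advisable Phi -> advisable Phi' ->
  advisable (fun u i j => Phi u i j /\ Phi' u i j).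
Proof.
move=> [P1 [C1 [R1 [rC1 rR1 blk1 ex1 RP1]]]] [P2 [C2 [R2 [rC2 rR2 blk2 ex2 RP2]]]].
pose p1 (x : G * (P1 * P2)) := (x.1, x.2.1).
pose p2 (x : G * (P1 * P2)) := (x.1, x.2.2).
pose f1 (x : G * (P1 * P2) * bool) := (p1 x.1, x.2).
pose f2 (x : G * (P1 * P2) * bool) := (p2 x.1, x.2).
exists (P1 * P2)%type, (fun s => C1 (map f1 s) /\ C2 (map f2 s)),
  (fun s i j => R1 (map f1 s) i j /\ R2 (map f2 s) i j); split.
- by apply: regularI; apply: regular_map.
- by apply: reg2_and; apply: reg2_map.
- move=> v; split; rewrite /blank -map_comp.
    by have := blk1 (map p1 v); rewrite /blank -map_comp.
  by have := blk2 (map p2 v); rewrite /blank -map_comp.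
- move=> u; have [v1 v1u C1v] := ex1 u; have [v2 v2u C2v] := ex2 u.
  have [|v vv1 vv2] := @relabel_pair _ _ v1 v2; first by rewrite v1u.
  exists v; first by rewrite -v1u -vv1 /relabel -map_comp.
  by move=> d; rewrite -!dmark_relabel vv1 vv2.
- move=> v i j d Cv vi vj vd.
  have := RP1 (relabel p1 v) i j d; have := RP2 (relabel p2 v) i j d.
  rewrite !has_datum_relabel !size_map !dmark_relabel.
  rewrite /relabel -!map_comp => -> //.
    move=> -> // d'; have [+ _] := Cv d'.
    by rewrite /dmark -!map_comp.
  by move=> d'; have [_ +] := Cv d'; rewrite /dmark -!map_comp.
Qed.

(** The advice gains one bit per position, the guessed truth value of the quantified relation there.
    In the word marked with the class of [i], [R] decides [Phi i k] for every [k], whatever datum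
    [k] carries, so this word suffices to check the bit at [i]; the new relation merely reads the
    bit. *)
Lemma advisable_ex Phi : advisable Phi ->
  advisable (fun u i _ => exists2 k, k < size u & Phi u i k).
Proof.
move=> [P [Cor [R [rCor rR blk ex RP]]]].
pose p (x : G * (P * bool)) := (x.1, x.2.1).
pose f (x : G * (P * bool) * bool) := (p x.1, x.2).
pose bit (s : seq (G * (P * bool) * bool)) i : bool :=
  oapp (fun x => x.1.2.2) false (onth s i).
pose own (s : seq (G * (P * bool) * bool)) i : bool := oapp snd false (onth s i).
have rbit : reg2 (fun s i _ => bit s i) by apply: reg2_label.
have rown : reg2 (fun s i _ => own s i) by apply: reg2_label.
have rRf : reg2 (fun s => R (map f s)) by apply: reg2_map.
(* The two added conditions say that a set bit has a witness and that a witness sets the bit. The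
   quantifier on [j] stands in front of the implications to match [regular_all_ex]. *)
exists (P * bool)%type, (fun s => Cor (map f s) /\
    ((forall i, i < size s -> exists2 j, j < size s &
        (own s i -> bit s i -> R (map f s) i j)) /\
     (forall i j, i < size s -> j < size s ->
        own s i -> R (map f s) i j -> bit s i))),
  (fun s i _ => bit s i); split=> //.
- apply: regularI; first exact: regular_map.
  apply: regularI; first by apply: regular_all_ex; do 2!apply: reg2_imply => //.
  by apply: regular_all_all; do 2!apply: reg2_imply => //.
- move=> v; have nown i : own (blank v) i = false.
    by rewrite /own /blank onth_map; case: (onth v i).
  split; last by split=> [i vi|i j _ _]; [exists i => //|]; rewrite nown.
  by have := blk (map p v); rewrite /blank -!map_comp.
- move=> u; have [v <- Cv] := ex u.
  pose b i := `[< exists d, has_datum v d i /\ exists2 j, j < size v & R (dmark v d) i j >].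
  have [v' vv' bv'] := relabel_bits_ex v b.
  exists v'; first by rewrite -vv' /relabel -map_comp.
  move=> d; rewrite -dmark_relabel vv'; split=> //.
  have szv : size (dmark v' d) = size v by rewrite -vv' !size_map.
  have ownE i : own (dmark v' d) i -> has_datum v d i.
    by move/has_datum_dmark; rewrite -vv' has_datum_relabel.
  rewrite szv; split.
  + move=> i vi; case: (pselect (own (dmark v' d) i /\ bit (dmark v' d) i)); last first.
      by move=> nob; exists i => // o bi; case: nob.
    case=> /ownE dvi; rewrite /bit bv' // => /asboolP[d' [d'vi [j vj Rij]]].
    by exists j => // _ _; rewrite (has_datum_inj dvi d'vi).
  + move=> i j vi vj /ownE dvi Rij; rewrite /bit bv' //; apply/asboolP.
    by exists d; split=> //; exists j.
- move=> v i j d Cv vi vj _.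
  (* The datum [d] may be that of the second position only. The bit at [i] is checked in the word
     marked with the datum [d0] of [i], and the bit itself does not depend on the marking. *)
  have [d0 vd0] := has_datum_ex vi.
  have Cp d' : Cor (dmark (relabel p v) d').
    by rewrite dmark_relabel; have [] := Cv d'.
  have -> : bit (dmark v d) i = bit (dmark v d0) i.
    by rewrite /bit /dmark !onth_map; case: (onth v i).
  have [_ [Cex Call]] := Cv d0; rewrite size_map in Cex Call.
  have ownd0 : own (dmark v d0) i by apply/has_datum_dmark.
  have RP' k : k < size v -> Phi (relabel fst v) i k <-> R (map f (dmark v d0)) i k.
    move=> vk; have := RP (relabel p v) i k d0 Cp.
    rewrite !has_datum_relabel !size_map dmark_relabel => <- //; last by left.
    by rewrite /relabel -map_comp.
  rewrite size_map; split.
    by move=> [k vk /(RP' k vk) Rk]; apply: (Call i k).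
  move=> bi; have [k vk Rk] := Cex i vi; exists k => //.
  by apply/(RP' k vk)/Rk.
Qed.

End Advisable.
End DataWords.

(** * From formulas to class automata *)

Section FormulasToClassAutomata.
Variables (D : Type) (Sigma : finType) (n : nat).
Local Notation G := (ext_letter Sigma n).
Implicit Types (u : seq (G * D)).

Definition ext_sets u : 'I_n -> set nat :=
  fun k i => oapp (fun x : G * D => k \in x.1.2) false (onth u i).

Lemma ext_word_ext_sets u : ext_word (ext_sets u) (relabel fst u) = map fst u.
Proof.
(* Generalised over the offset [m], since the numbering shifts along the induction. *)
rewrite /ext_word; suff H : forall m (Y : 'I_n -> set nat),
    (forall k i, Y k (m + i) <-> ext_sets u k i) ->
    [seq (p.1.1, [set k | p.2 \in Y k]%SET) |
       p <- zip (relabel fst u) (iota m (size (relabel fst u)))] = map fst u.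
  exact: H.
elim: u => [|[[a S] d] u IH] m Y YP //=; congr (_ :: _).
  congr (_, _); apply/setP => k; rewrite inE.
  by apply/idP/idP; rewrite inE => /=; have := YP k 0; rewrite addn0 => ->.
by apply: IH => k i; rewrite addSnnS YP.
Qed.

(** The sets are written into the labels; as they contain positions of [w] only, they are recovered
    exactly. *)
Lemma ext_sets_ex (w : data_word Sigma D) (X : 'I_n -> set nat) :
  (forall k, X k `<=` [set i | i < size w]) ->
  exists2 u, relabel fst u = w & ext_sets u = X.
Proof.
elim: w X => [|[a d] w IH] X XP.
  exists [::] => //; apply/funext => k; apply/funext => i; apply/propext.
  by rewrite /ext_sets onth0n; split=> // /(XP k i).
have [|u <- uX] := IH (fun k i => X k i.+1); first by move=> k i /(XP k i.+1).
exists ((a, [set k | 0 \in X k]%SET, d) :: u) => //.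
apply/funext => k; apply/funext => -[|i]; last first.
  by rewrite -[RHS](congr1 (fun Y => Y k i) uX).
by apply/propext; rewrite /ext_sets /= inE; split; rewrite inE.
Qed.

Definition env (i j : nat) (t : var) : nat := if t is vx then i else j.

Lemma advisable_eq : advisable (fun u i j => i = j).
Proof.
apply: (advisable_reg2 (R := fun _ i j => ~ i < j /\ ~ j < i)).
  by apply: reg2_and; apply: reg2_not; [|apply: reg2_swap]; apply: reg2_lt.
move=> u i j d _ _ _; split=> [->|[/negP + /negP]]; first by rewrite ltnn.
by rewrite -!leqNgt => ji ij; apply/eqP; rewrite eqn_leq ij ji.
Qed.

(** The arguments of an atom may be swapped or equal. The diagonal [Phi i i] is obtained as the
    existence of some [k] equal to [i] with [Phi i k]. *)
Lemma advisable_vars (Phi : seq (G * D) -> nat -> nat -> Prop) s t :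
  advisable Phi -> advisable (fun u i j => Phi u (env i j s) (env i j t)).
Proof.
move=> aPhi.
have diag : advisable (fun u i _ => Phi u i i).
  apply: eq_advisable (advisable_ex (advisable_and advisable_eq aPhi)).
  move=> u i j ui _; split=> [[k _ [<-]]//|Pii].
  by exists i.
case: s t => -[] //=; first exact: advisable_swap.
exact: advisable_swap diag.
Qed.

(** Induction on the formula: atoms are regular in the word marked with the class of one argument,
    connectives combine advice, and each quantifier adds a bit. Disjunction and universal
    quantification go by duality. *)
Lemma sat_advisable (phi : fo2 Sigma n) :
  advisable (fun u i j => sat (relabel fst u) (ext_sets u) (env i j) phi).
Proof.
have rown : reg2 (fun (s : seq (G * bool)) i _ => oapp snd false (onth s i)).
  exact: reg2_label.
(* As [advisable_ex] quantifies the second argument, the arguments are swapped before and after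
   quantifying over [vx]. *)
have exE psi t : advisable (fun u i j => sat (relabel fst u) (ext_sets u) (env i j) psi) ->
  advisable (fun u i j => sat (relabel fst u) (ext_sets u) (env i j) (FEx t psi)).
  have upd i j k : update (env i j) t k = if t is vx then env k j else env i k.
    by case: t => /=; apply/funext => -[].
  move=> apsi; case: t upd => /= upd.
  + apply: eq_advisable (advisable_swap (advisable_ex (advisable_swap apsi))).
    by move=> u i j _ _; rewrite size_map; split=> -[k uk sk]; exists k => //; move: sk; rewrite upd.
  + apply: eq_advisable (advisable_ex apsi).
    by move=> u i j _ _; rewrite size_map; split=> -[k uk sk]; exists k => //; move: sk; rewrite upd.
elim: phi => [a t|k t|s t|s t|s t|s t|s t|L rL s t|f IH|f IHf g IHg|f IHf g IHg|t f IH|t f IH] /=.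
- apply: (@advisable_vars (fun u i _ => has_letter (relabel fst u) a i) t t).
  apply: (advisable_reg2 (reg2_label (fun x : G * bool => x.1.1 == a))).
  move=> u i j d _ _ _; rewrite /has_letter !onth_map.
  case: (onth u i) => [[[a' S] d']|] /=; last by split=> // -[].
  by split=> [[? [->]]|/eqP->]; last exists d'.
- apply: (@advisable_vars (fun u i _ => ext_sets u k i) t t).
  apply: (advisable_reg2 (reg2_label (fun x : G * bool => k \in x.1.2))).
  by move=> u i j d _ _ _; rewrite /ext_sets !onth_map; case: (onth u i).
- exact: (@advisable_vars (fun u i j => i = j) s t advisable_eq).
- apply: (@advisable_vars (fun u i j => i < j) s t).
  by apply: (advisable_reg2 (@reg2_lt _)) => u i j d.
- apply: (@advisable_vars (fun u i j => succ_pos (relabel fst u) i j) s t).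
  (* The successor is a later position with the empty word in between, the only word satisfying
     [all pred0]. *)
  apply: (advisable_reg2 (reg2_between (regular_all pred0))).
  move=> u i j d ui uj _; rewrite /succ_pos size_map uj.
  have szb : size (between (dmark u d) i j) = j - i.+1.
    by rewrite /between size_drop size_takel ?size_map // ltnW.
  split=> [[_ ji]|[ij]].
    have /size0nil -> // : size (between (dmark u d) i j) = 0.
      by rewrite szb ji subnn.
    by rewrite ji.
  case: (between _ _ _) szb => //= /esym/eqP; rewrite subn_eq0 => ji _.
  by split=> //; apply/eqP; rewrite eqn_leq ij ji.
- apply: (@advisable_vars (fun u i j => same_data (relabel fst u) i j) s t).
  apply: (advisable_reg2 (reg2_and rown (reg2_swap rown))).
  move=> u i j d ui uj udij; rewrite -!has_datum_dmark.
  by rewrite (@same_dataE _ _ _ d) !has_datum_relabel.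
- apply: (@advisable_vars (fun u i j => class_succ (relabel fst u) i j) s t).
  (* Class successor: both positions are marked, and no position between them is. *)
  have rbl := reg2_between (regular_all (fun x : G * bool => ~~ x.2)).
  apply: (advisable_reg2 (reg2_and (reg2_and rown (reg2_swap rown)) rbl)).
  move=> u i j d ui uj udij; rewrite -!has_datum_dmark /class_succ.
  rewrite all_betweenP ?size_map; last exact: ltnW.
  have := @same_dataE _ _ (relabel fst u) d i j.
  rewrite !has_datum_relabel => /(_ udij) sij.
  have unmarked k : k < j -> has_datum u d i ->
      oapp (fun x => ~~ x.2) false (onth (dmark u d) k) <->
      ~ same_data (relabel fst u) i k.
    move=> kj ud; rewrite (@same_dataE _ _ _ d) !has_datum_relabel; last by left.
    have : k < size (dmark u d) by rewrite size_map (ltn_trans kj).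
    rewrite (has_datum_dmark u d k) -onthTE; case: (onth _ k) => //= x _.
    by split=> [/negP nx []|nx]; [|apply/negP => x2; apply: nx].
  split=> [[ij /sij[udi udj] H]|[[udi udj] [ij H]]]; split=> //.
    by split=> // k /andP[ik kj]; apply/unmarked => //; apply: H; rewrite ik.
    exact/sij.
  by move=> k /andP[ik kj]; apply/unmarked => //; apply: H; rewrite ik.
- apply: (@advisable_vars (fun u i j =>
    i < j /\ L (between (ext_word (ext_sets u) (relabel fst u)) i j)) s t).
  apply: (advisable_reg2 (reg2_map fst (reg2_between rL))).
  move=> u i j d _ _ _; rewrite ext_word_ext_sets.
  by rewrite /dmark -map_comp.
- exact: advisable_not.
- exact: advisable_and.
- apply: eq_advisable (advisable_not (advisable_and (advisable_not IHf) (advisable_not IHg))).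
  by move=> u i j _ _; rewrite -not_orE; split=> [/contrapT|? ?].
- exact: exE.
- apply: eq_advisable (advisable_not (exE (FNot f) t (advisable_not IH))).
  move=> u i j _ _ /=; split=> [H k uk|H [k uk]]; last by apply; apply: H.
  by apply: contrapT => nk; apply: H; exists k.
Qed.

End FormulasToClassAutomata.

(** The relabelled word [v] is the guess of the class automaton. The unmarked word is the view of a
    datum that does not occur in it. *)
Definition class_language (D : Type) (Sigma B : finType) (f : B -> Sigma)
    (A : dfa (B * bool)%type) : data_language Sigma D :=
  [set w | exists v, [/\ relabel f v = w, dfa_accepts A (blank (map fst v)) &
     forall d, dfa_accepts A (dmark v d)]].

Lemma emso2_class_language (D : Type) (Sigma : finType) (phi : emso2 Sigma) :
  exists (B : finType) (f : B -> Sigma) (A : dfa (B * bool)%type),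
    emso2_language phi = class_language f A :> data_language Sigma D.
Proof.
case: phi => n phi cphi.
have [P [Cor [R [rCor rR blk ex RP]]]] := @sat_advisable D Sigma n phi.
(* The truth value on the empty data word, which has no first position at which to evaluate the
   sentence. *)
pose b := `[< @sat Sigma D n [::] (fun=> set0) (fun=> 0) phi >].
pose T := (ext_letter Sigma n * P * bool)%type.
pose own (s : seq T) i : bool := oapp snd false (onth s i).
have rown : reg2 (fun s i _ => own s i) by apply: reg2_label.
(* The third condition evaluates the sentence at the first position, which
   matters only for the word marked with the class of that position. *)
have [A AP] : regular (fun s => Cor s /\ ((all pred0 s -> b) /\
    forall i, i < size s -> exists2 j, j < size s &
      own s i -> ~ j < i -> ~ i < j /\ R s i j)).
  apply: regularI => //; apply: regularI.
    case: b; first by apply: (eq_regular _ (regular_all predT)) => s; rewrite all_predT.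
    apply: (eq_regular _ (regularC (regular_all pred0))) => s.
    by split=> [nall all0|nall /nall].
  apply: regular_all_ex; apply: reg2_imply => //; apply: reg2_imply.
    by apply: reg2_not; apply: reg2_swap; apply: reg2_lt.
  by apply: reg2_and => //; apply: reg2_not; apply: reg2_lt.
have satE (v : seq (ext_letter Sigma n * P * D)) : (forall d, Cor (dmark v d)) ->
    sat (relabel fst (relabel fst v)) (ext_sets (relabel fst v)) (fun=> 0) phi <->
    dfa_accepts A (blank (map fst v)) /\ forall d, dfa_accepts A (dmark v d).
  move=> Cv.
  have ownB s i : own (blank s) i = false.
    by rewrite /own /blank onth_map; case: (onth s i).
  case: v Cv => [|x v] Cv.
    rewrite /=; have -> : @ext_sets D Sigma n [::] = (fun=> set0).
      by apply/funext => k; apply/funext => i; apply/propext; rewrite /ext_sets onth0n.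
    split.
      move=> /asboolP sb; split; last first.
        by move=> d; apply/AP; split; [apply: Cv|split=> [_|i //]; apply: sb].
      by apply/AP; split; [apply: (blk [::])|split=> [_|i //]; apply: sb].
    by move=> [/AP[_ [/(_ isT)/asboolP //]]].
  have xd : has_datum (x :: v) x.2 0 by exists x.1; case: (x).
  have envE : (fun=> 0) = env 0 0 by apply/funext => -[].
  rewrite envE (RP _ _ _ x.2) //; last by left.
  split.
    move=> R00; split.
      apply/AP; split=> //; split=> // i vi; exists i => //; by rewrite ownB.
    (* The witness is always [j = 0]: it contradicts [~ j < i] when [i] is positive, and when [i] is
       0 the mark forces [d] to be the datum of the first position. *)
    move=> d; apply/AP; split=> //; split=> // -[|i] vi; last by exists 0.
    exists 0 => //; move=> /has_datum_dmark own0 _; split=> //.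
    by rewrite (has_datum_inj own0 xd).
  move=> [_ /(_ x.2)/AP[_ [_ /(_ 0)]]] [] // j _ [].
  - exact/has_datum_dmark.
  - by [].
  by case: j.
exists (ext_letter Sigma n * P)%type, (fun x => x.1.1), A.
apply/seteqP; split=> w /=.
- move=> [X [/ext_sets_ex[u <- <-] us]].
  have [v vu Cv] := ex u; exists v.
  rewrite -vu in us *; have [? ?] := (satE v Cv).1 us; split=> //.
  by rewrite /relabel -map_comp.
- move=> [v [<- bv dv]].
  have Cv d : Cor (dmark v d) by have /AP[] := dv d.
  exists (ext_sets (relabel fst v)); split.
    move=> k i /=; rewrite /ext_sets size_map -(size_map (fun x => (x.1.1, x.2))) -onthTE.
    by rewrite /relabel; case: onth.
  suff -> : relabel (fun x => x.1.1) v = relabel fst (relabel fst v) by apply/satE.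
  by rewrite /relabel -map_comp.
Qed.

(** * From class automata to set automata *)

Lemma set_updateE (Sigma : finType) (D : Type) (A : set_automaton Sigma)
    (rho : brel (sa_name A)) (u v : bvec (sa_name A)) (d : D) X y d' :
  set_update rho u v d X y d' <->
  ((exists2 x, (x, y) \in rho & X x d') \/ (u y /\ d' = d)) /\
  ~ (v y /\ d' = d).
Proof.
rewrite /set_update /data_if; split.
  move=> [Xd vd]; split; last by case=> vy d'd; apply: vd; rewrite vy.
  case: Xd => [[x]|]; first by left; exists x.
  by case: ifP => // _ ->; right.
move=> [Xd vd]; split; last by case: ifP => // vy d'd; apply: vd.
by case: Xd => [[x xy Xx]|[-> ->]]; [left; exists x|right].
Qed.

Section ClassAutomataToSetAutomata.
Variables (D : Type) (Sigma B : finType) (f : B -> Sigma) (A : dfa (B * bool)%type).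
Local Notation S := (dfa_state A).
Local Notation step := (@dfa_trans _ A).
Implicit Types (v : seq (B * D)) (d : D).

Definition onehot (o : option S) : bvec S := [ffun y => Some y == o].

Lemma onehot_inj : injective onehot.
Proof.
move=> [s|] [s'|] //= /ffunP e.
- by have := e s; rewrite !ffunE eqxx => /esym/eqP.
- by have := e s; rewrite !ffunE eqxx.
- by have := e s'; rewrite !ffunE eqxx.
Qed.

(* The control state is the state of [A] on the unmarked word, which is also the
   state of every datum not seen yet; a seen datum lies in exactly one set,
   named after the state of [A] on the word marked with it. *)
Definition class_trans (x : S * B * option S) :
    S * Sigma * bvec S * brel S * bvec S * bvec S * S :=
  let: (q, b, o) := x in
  let t := step (odflt q o) (b, true) in
  (q, f b, onehot o, [set p | step p.1 (b, false) == p.2]%SET,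
   onehot (Some t), [ffun y => y != t], step q (b, false)).

Definition class_set_automaton : set_automaton Sigma :=
  SetAutomaton [set class_trans x | x : S * B * option S]%SET
    [set dfa_init A]%SET (dfa_final A)
    [set onehot (Some s) | s in dfa_final A]%SET.

Definition dstate v d : S := foldl step (dfa_init A) (dmark v d).

Definition bstate v : S := foldl step (dfa_init A) (blank (map fst v)).

Definition seen v d : bool := has snd (dmark v d).

Lemma dstate_rcons v b d d' :
  dstate (rcons v (b, d)) d' = step (dstate v d') (b, `[< d = d' >]).
Proof. by rewrite /dstate /dmark map_rcons foldl_rcons. Qed.

Lemma bstate_rcons v b d : bstate (rcons v (b, d)) = step (bstate v) (b, false).
Proof. by rewrite /bstate /blank !map_rcons foldl_rcons. Qed.

Lemma seen_rcons v b d d' : seen (rcons v (b, d)) d' = `[< d = d' >] || seen v d'.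
Proof. by rewrite /seen /dmark map_rcons has_rcons. Qed.

Lemma unseen_dstate v d : ~~ seen v d -> dstate v d = bstate v.
Proof.
rewrite /seen /dstate /bstate => nd; congr foldl.
by elim: v nd => //= -[b d'] v IH /=; rewrite negb_or => /andP[/negbTE-> /IH->].
Qed.

Definition profile v d : option S := if seen v d then Some (dstate v d) else None.

(** Invariant of the simulation once [v] has been read: a seen datum lies in exactly one set, an
    unseen one in none. *)
Definition tracks v (c : config D class_set_automaton) : Prop :=
  c.1 = bstate v /\ forall s d, c.2 s d <-> profile v d = Some s.

Lemma tracks_char_vec v c d : tracks v c -> char_vec c.2 d = onehot (profile v d).
Proof.
case=> _ cP; apply/ffunP => s; rewrite !ffunE.
apply/idP/idP; first by rewrite inE => /cP ->.
by move/eqP/esym/cP; rewrite inE.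
Qed.

(** The default in [odflt] is right because an unseen datum is in the state of the unmarked word.
    The relation advances every stored datum as unmarked, [d] included; adding [d] to its true state
    and removing it from all other names corrects this. *)
Lemma tracks_step v c b d q a z rho u u' q' : tracks v c ->
  class_trans (bstate v, b, profile v d) = (q, a, z, rho, u, u', q') ->
  tracks (rcons v (b, d))
    (q', set_update (A := class_set_automaton) rho u u' d c.2).
Proof.
move=> [cq cP] [_ _ _ <- <- <- <-]; split; first by rewrite bstate_rcons.
have tE : odflt (bstate v) (profile v d) = dstate v d.
  by rewrite /profile; case: ifP => //= /negbT/unseen_dstate.
move=> s d'; rewrite [X in X <-> _]set_updateE /profile seen_rcons dstate_rcons tE !ffunE /=.
have [->|dd'] := pselect (d = d').
  have -> : `[< d' = d' >] by apply/asboolP.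
  rewrite /= (_ : (Some s == Some _) = (s == step (dstate v d') (b, true))) //.
  case: eqP => [->|ne]; first by split=> // _; split; [right|case].
  by split=> [[_ []]|[/esym]].
have -> : `[< d = d' >] = false by apply/asboolP.
rewrite /=; split.
  move=> [[[s' s's /cP p]|[_ /esym //]] _]; rewrite inE /= in s's.
  by move: p; rewrite /profile; case: ifP => // _ [->]; rewrite (eqP s's).
case: ifP => // sd [es]; split; last by case=> _ /esym.
left; exists (dstate v d'); first by rewrite inE /= es.
by apply/cP; rewrite /profile sd.
Qed.

(** The final control states account for the unmarked word and all unseen data at once, and [sa_acc]
    for the seen data. *)
Lemma tracks_accepting v c : tracks v c ->
  accepting c <-> dfa_accepts A (blank (map fst v)) /\
    forall d, dfa_accepts A (dmark v d).
Proof.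
move=> tc; case: (tc) => cq cP; rewrite /accepting cq /=; split.
  case=> bF acc; split=> // d; rewrite /dfa_accepts -/(dstate v d).
  have [sd|/unseen_dstate->//] := boolP (seen v d).
  have cd : c.2 (dstate v d) d by apply/cP; rewrite /profile sd.
  have := acc d (ex_intro (fun y => c.2 y d) _ cd); rewrite (tracks_char_vec _ tc).
  by rewrite /profile sd => /imsetP[s sF /onehot_inj[->]].
case=> bF dF; split=> // d [s /cP ds]; rewrite (tracks_char_vec _ tc) ds.
apply/imsetP; exists s => //; move: ds; rewrite /profile; case: ifP => // _ [<-].
exact: dF.
Qed.

(** Choosing a transition amounts to choosing the letter [b], so the continuations of a run are the
    relabellings [v'] of the rest of the word. *)
Lemma tracks_run w v c : tracks v c ->
  (exists2 c', sa_run c w c' & accepting c') <->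
  exists2 v', relabel f v' = w &
    dfa_accepts A (blank (map fst (v ++ v'))) /\
    forall d, dfa_accepts A (dmark (v ++ v') d).
Proof.
elim: w v c => [|[a d] w IH] v c tc /=.
  split=> [[c' <-] /(tracks_accepting tc) ac|].
    by exists [::]; rewrite ?cats0.
  move=> [[|//] _]; rewrite cats0 => ac.
  by exists c => //; apply/(tracks_accepting tc).
split.
  move=> [c' [c1 [rho [u [u' [/imsetP[[[q b] o] _ /= tE] c1E]]]] r1] ac].
  have [cq aE zE] := tE; rewrite (tracks_char_vec _ tc) in zE.
  (* The vector test forces the component [o] of the transition to be the profile of [d]. *)
  move: zE => /onehot_inj oE _ _ _ _.
  rewrite -/(class_trans (q, b, o)) -cq -oE (proj1 tc) in tE.
  have tc1 := tracks_step tc (esym tE); rewrite -c1E -surjective_pairing in tc1.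
  have [v' <- av'] := (IH _ _ tc1).1 (ex_intro2 _ _ c' r1 ac).
  by exists ((b, d) :: v'); rewrite /= -?cat_rcons // aE.
move=> [[//|[b d'] v'] [<- <- {d}w'E]]; rewrite -cat_rcons => av'.
case tE: (class_trans (bstate v, b, profile v d')) => [[[[[[q a'] z] rho] u] u'] q'].
have tc1 := tracks_step tc tE.
have [c' r1 ac] := (IH _ _ tc1).2 (ex_intro2 _ _ v' w'E av').
exists c' => //.
exists (q', set_update (A := class_set_automaton) rho u u' d' c.2) => //.
exists rho, u, u'; split=> //; apply/imsetP; exists (bstate v, b, profile v d') => //.
rewrite tE (proj1 tc) (tracks_char_vec _ tc) /=.
by move: tE => /= [<- <- <- _ _ _ _].
Qed.

Lemma class_set_automatonE :
  sa_language class_set_automaton = class_language f A :> data_language Sigma D.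
Proof.
have t0 : tracks [::] (dfa_init A, fun=> set0) by [].
apply/seteqP; split=> w /=.
  move=> [[q X] [c' [[/= qI X0] rw ac]]].
  have {X0}XE : X = fun=> set0 by apply/funext.
  rewrite inE in qI; rewrite {}XE (eqP qI) in rw.
  have [v <- [bv dv]] := (tracks_run w t0).1 (ex_intro2 _ _ c' rw ac).
  by exists v.
move=> [v [vw bv dv]].
have [c' rw ac] := (tracks_run w t0).2 (ex_intro2 _ _ v vw (conj bv dv)).
by exists (dfa_init A, fun=> set0), c'; split=> //; split; rewrite //= inE.
Qed.

End ClassAutomataToSetAutomata.

(** * From set automata to formulas: runs written as labels *)

Section SetAutomataToFormulas.
Variables (D : Type) (Sigma : finType) (A : set_automaton Sigma).
Local Notation Q := (sa_state A).
Local Notation Y := (sa_name A).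
Local Notation Z := (bvec Y).

Definition transition : finType := (Q * Sigma * Z * brel Y * Z * Z * Q)%type.

Local Notation n := #|transition|.
Local Notation G := (ext_letter Sigma n).
Implicit Types (g : G) (u : seq (G * D)) (d : D) (z : Z) (q : Q).

(* There is one set variable per transition: a position whose label contains the
   code of [t] is where the guessed run takes [t]. *)
Definition trans_of g : option transition := omap enum_val [pick k in g.2].

Definition trans_code (t : transition) : G :=
  (t.1.1.1.1.1.2, [set enum_rank t]%SET).

Lemma trans_codeK t : trans_of (trans_code t) = Some t.
Proof.
rewrite /trans_of; case: pickP => [k|/(_ (enum_rank t))]; last by rewrite /= inE eqxx.
by rewrite /= inE => /eqP->; rewrite enum_rankK.
Qed.

Definition src g : option Q := omap (fun t : transition => t.1.1.1.1.1.1) (trans_of g).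
Definition tgt g : option Q := omap snd (trans_of g).
Definition test g : option Z := omap (fun t : transition => t.1.1.1.1.2) (trans_of g).
Definition valid g : bool :=
  oapp (fun t : transition => (t \in sa_delta A) && (t.1.1.1.1.1.2 == g.1))
    false (trans_of g).

(** Effect of a position on the characteristic vector of a datum: [move] if the position carries
    another datum, [touch] if it carries this one. Where no transition is coded both are the
    identity. *)
Definition move z g : Z :=
  oapp (fun t : transition => [ffun y => [exists x, ((x, y) \in t.1.1.1.2) && z x]])
    z (trans_of g).
Definition touch g z : Z :=
  oapp (fun t : transition => [ffun y => (move z g y || t.1.1.2 y) && ~~ t.1.2 y])
    z (trans_of g).

Definition zero : Z := [ffun=> false].
(** A datum lying in no set at the end is exempt from the acceptance condition. *)
Definition zok z : bool := (z == zero) || (z \in sa_acc A).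

(** A datum enters no set before it is first read, which fixes its vector at the first
    occurrence. *)
Lemma move_zero g : move zero g = zero.
Proof.
rewrite /move; case: trans_of => //= t; apply/ffunP => y; rewrite !ffunE.
by apply/existsP => -[x]; rewrite ffunE andbF.
Qed.

Definition zstep d z (x : G * D) : Z :=
  if `[< x.2 = d >] then touch x.1 z else move z x.1.

Lemma char_vec_eq0 (X : Y -> set D) d : char_vec X d = zero <-> ~ exists y, X y d.
Proof.
split=> [/ffunP c0 [y Xy]|nX].
  by have := c0 y; rewrite !ffunE => /negbT/negP; apply; rewrite inE.
apply/ffunP => y; rewrite !ffunE; apply/negP; rewrite inE => Xy.
by apply: nX; exists y.
Qed.

(** The vector of a datum evolves independently of the other vectors, so a run splits into a control
    sequence and one finite-state run per datum. *)
Lemma char_vec_update g t (X : Y -> set D) d d' : trans_of g = Some t ->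
  char_vec (set_update t.1.1.1.2 t.1.1.2 t.1.2 d X) d' = zstep d' (char_vec X d') (g, d).
Proof.
move=> gt; apply/ffunP => y; rewrite !ffunE.
have -> : (d' \in set_update t.1.1.1.2 t.1.1.2 t.1.2 d X y) =
    `[< set_update t.1.1.1.2 t.1.1.2 t.1.2 d X y d' >].
  by apply/idP/asboolP; rewrite inE.
have moveP : move (char_vec X d') g y <-> exists2 x, (x, y) \in t.1.1.1.2 & X x d'.
  rewrite /move gt /= ffunE; split.
    by move=> /existsP[x /andP[xy]]; rewrite ffunE inE; exists x.
  by move=> [x xy Xx]; apply/existsP; exists x; rewrite xy ffunE inE.
rewrite /zstep /=; case: (@asboolP (d = d')) => [e|dd']; [subst d'|]; apply/asboolP/idP => [/set_updateE|H].
- rewrite /touch gt /= ffunE => -[[/moveP mv|[-> _]] nv]; last first.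
    by rewrite orbT /=; apply/negP => v; apply: nv.
  by rewrite mv /=; apply/negP => v; apply: nv.
- move: H; rewrite /touch gt /= ffunE => /andP[/orP[/moveP H|uy] /negP nv].
    by apply/set_updateE; split; [left|case].
  by apply/set_updateE; split; [right|case].
- by move=> [[/moveP//|[_ /esym]]].
- by apply/set_updateE; split; [left; apply/moveP|case=> _ /esym].
Qed.

(** The function [zf] replaces the sets of a configuration by the vectors of all data. *)
Fixpoint good_run q (zf : D -> Z) u : Prop :=
  if u is x :: u' then
    [/\ valid x.1, src x.1 = Some q, test x.1 = Some (zf x.2) &
        exists2 q', tgt x.1 = Some q' & good_run q' (fun d => zstep d (zf d) x) u']
  else q \in sa_final A /\ forall d, zok (zf d).

Lemma sa_run_good w (c : config D A) :
  (exists2 c', sa_run c w c' & accepting c') <->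
  exists2 u, relabel fst u = w & good_run c.1 (char_vec c.2) u.
Proof.
elim: w c => [|[a d] w IH] c /=.
  have accE : accepting c <-> c.1 \in sa_final A /\ forall d, zok (char_vec c.2 d).
    split=> -[cF acc]; split=> // d.
      rewrite /zok; case: eqP => //= /char_vec_eq0; rewrite notK => /acc //.
    move=> cd; have /orP[/eqP/char_vec_eq0|//] := acc d.
    by move=> nc; case: nc.
  split=> [[c' <- /accE] ?|[[|//] _ /accE]]; [by exists [::]|by exists c].
split.
- move=> [c' [c1 [rho [u [v [tD c1E]]]] r1] ac].
  have [u' u'w gr] := (IH c1).1 (ex_intro2 _ _ c' r1 ac).
  set t : transition := (_, c1.1) in tD.
  exists ((trans_code t, d) :: u'); first by rewrite /= u'w.
  rewrite /= /valid /src /test /tgt trans_codeK /= tD eqxx; split=> //.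
  exists c1.1 => //; congr good_run: gr; apply/funext => d'.
  by rewrite c1E -(char_vec_update _ _ _ (trans_codeK t)).
- move=> [[//|[g d'] u] [<- <- {d}uw] [/= vg sg tg [q' tgtg gr]]].
  case gt: (trans_of g) vg sg tg tgtg => [t|]; rewrite /valid /src /test /tgt gt //=.
  move=> /andP[tD /eqP tg] [cs] [cz] [ct].
  pose c1 : config D A := (q', set_update t.1.1.1.2 t.1.1.2 t.1.2 d' c.2).
  have [|c' r1 ac] := (IH c1).2.
    exists u => //; congr good_run: gr; apply/funext => d /=.
    by rewrite (char_vec_update _ _ _ gt).
  exists c' => //; exists c1 => //; exists t.1.1.1.2, t.1.1.2, t.1.2; split=> //=.
  by move: tD; rewrite -cs -cz -ct -tg; case: (t) => [[[[[[? ?] ?] ?] ?] ?] ?].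
Qed.

(** * Local conditions on the control states and on each class *)

Definition fin g : bool := oapp (mem (sa_final A)) false (tgt g).

(** Stated through single positions and pairs of neighbours, as a two-variable formula can express
    it. *)
Definition chain q (s : seq G) : bool :=
  if s is g :: s' then
    [&& src g == Some q, all valid s, path (fun g g' => tgt g == src g') g s' &
        fin (last g s')]
  else q \in sa_final A.

Lemma chain_cons q g s : chain q (g :: s) <->
  [/\ valid g, src g = Some q & exists2 q', tgt g = Some q' & chain q' s].
Proof.
have valid_src g' : valid g' -> exists q', src g' = Some q'.
  rewrite /valid /src; case: (trans_of g') => // t _; by eexists.
rewrite /chain /=; split.
- case/and4P=> /eqP sg /andP[vg vs] pgs fgs; split=> //.
  case: s vs pgs fgs => [|g' s] /=.
    by move=> _ _; rewrite /fin; case: tgt => // q' q'F; exists q'.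
  move=> /andP[vg' vs] /andP[/eqP tg pgs] ->.
  by have [q' e] := valid_src _ vg'; exists q'; rewrite ?tg // e eqxx vg' vs pgs.
- move=> [-> -> [q' tg]]; rewrite eqxx; case: s => [|g' s] /=.
    by rewrite /fin tg.
  by case/and4P=> /eqP-> -> -> ->; rewrite tg eqxx.
Qed.

Definition zrun d z u : Z := foldl (zstep d) z u.

(** Since [zrun] computes every vector from the prefix, the control part and the data part of a run
    become separate conditions. *)
Lemma good_runE q zf u : good_run q zf u <->
  [/\ chain q (map fst u),
      forall i x, onth u i = Some x -> test x.1 = Some (zrun x.2 (zf x.2) (take i u)) &
      forall d, zok (zrun d (zf d) u)].
Proof.
elim: u q zf => [|x u IH] q zf.
  by split=> [[qF ok]|[qF _ ok]]; split=> // i x; rewrite onth0n.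
split.
- move=> [vx sx tx [q' tgtx /IH[cu tu ok]]]; split=> //.
    by apply/chain_cons; split=> //; exists q'.
  by move=> [|i] y; [case=> <-|apply: tu].
- move=> [/chain_cons[vx sx [q' tgtx cu]] tu ok]; split=> //.
    exact: (tu 0 x erefl).
  exists q' => //; apply/IH; split=> // i y uy.
  exact: (tu i.+1 y uy).
Qed.

(** The vector just after the position, computed from the guessed test instead of the prefix and
    hence a function of the label alone. *)
Definition touched g : Z := oapp (touch g) zero (test g).

Lemma zrun_unseen d z u : all (fun x => ~~ `[< x.2 = d >]) u ->
  zrun d z u = foldl move z (map fst u).
Proof.
elim: u z => //= x u IH z /andP[/negbTE nx /IH <-].
by rewrite /zrun /= /zstep nx.
Qed.

Lemma foldl_move_zero (s : seq G) : foldl move zero s = zero.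
Proof. by elim: s => //= g s IH; rewrite move_zero. Qed.

Lemma zrun_between d z u i j x : onth u i = Some x -> x.2 = d -> i < j ->
  all (fun x => ~~ `[< x.2 = d >]) (between u i j) ->
  zrun d z (take j u) =
  foldl move (touch x.1 (zrun d z (take i u))) (map fst (between u i j)).
Proof.
move=> ui xd ij nd; rewrite -(zrun_unseen _ nd).
have -> : take j u = take i u ++ x :: between u i j.
  rewrite /between; elim: u i j ui ij {nd} => [|y u IH] [|i] [|j] //=.
    by case=> ->; rewrite drop0.
  by rewrite ltnS => ui ij; rewrite -IH.
by rewrite /zrun foldl_cat /= /zstep (asboolT xd).
Qed.

Local Notation word u := (relabel fst u : data_word Sigma D).

Lemma same_dataP u i j : same_data (word u) i j <->
  exists x y, [/\ onth u i = Some x, onth u j = Some y & x.2 = y.2].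
Proof.
split=> [[d]|[x [y [ui uj xy]]]].
  rewrite !has_datum_relabel => -[g ui] [g' uj].
  by exists (g, d), (g', d).
exists x.2; rewrite has_datum_relabel; first by exists x.1; rewrite ui; case: (x).
by exists y.1; rewrite uj xy; case: (y).
Qed.

(** Initial value, propagation and final check of the vector along a class, none of which refers to
    a whole prefix. *)
Definition class_rules u : Prop := [/\
  forall i x, onth u i = Some x -> ~ (exists k, class_succ (word u) k i) ->
    test x.1 = Some zero,
  forall i j x y, onth u i = Some x -> onth u j = Some y -> class_succ (word u) i j ->
    test y.1 = Some (foldl move (touched x.1) (map fst (between u i j))) &
  forall i x, onth u i = Some x -> ~ (exists k, class_succ (word u) i k) ->
    zok (foldl move (touched x.1) (map fst (between u i (size u))))].

Lemma onth_lt T (s : seq T) i x : onth s i = Some x -> i < size s.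
Proof. by rewrite -onthTE => ->. Qed.

Lemma class_succ_unseen u i j x : onth u i = Some x -> j <= size u ->
  (forall k, i < k < j -> ~ same_data (word u) i k) ->
  all (fun y => ~~ `[< y.2 = x.2 >]) (between u i j).
Proof.
move=> ui ju nk; apply/all_betweenP => // k ikj.
have : k < size u by case/andP: ikj => _ kj; apply: leq_trans kj ju.
rewrite -onthTE; case uk : (onth u k) => [y|] //= _.
apply/asboolPn => yx; apply: (nk k ikj); apply/same_dataP.
by exists x, y.
Qed.

Lemma class_pred_ex u i j x y : onth u i = Some x -> onth u j = Some y -> x.2 = y.2 ->
  i < j -> exists k, class_succ (word u) k j.
Proof.
move=> ui uj xy ij.
pose p k := (k < j) && `[< same_data (word u) k j >].
have pex : exists k, p k.
  by exists i; rewrite /p ij; apply/asboolP/same_dataP; exists x, y.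
have pub k : p k -> k <= j by case/andP=> /ltnW.
case: (ex_maxnP pex pub) => k /andP[kj /asboolP skj] kmax.
exists k; split=> // l /andP[kl lj] skl.
suff /kmax : p l by rewrite leqNgt kl.
rewrite /p lj; apply/asboolP.
by case: skl skj => d dk dl [d' d'k d'j]; exists d => //; rewrite (has_datum_inj dk d'k).
Qed.

Lemma class_succ_last u i x : onth u i = Some x ->
  ~ (exists k, class_succ (word u) i k) ->
  forall k, i < k < size u -> ~ same_data (word u) i k.
Proof.
move=> ui nsucc k /andP[ik _] sik.
pose p k := (i < k) && `[< same_data (word u) i k >].
have pex : exists k, p k by exists k; rewrite /p ik; apply/asboolP.
case: (ex_minnP pex) => l /andP[il /asboolP sil] lmin.
apply: nsucc; exists l; split=> // m /andP[im ml] sim.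
suff /lmin : p m by rewrite leqNgt ml.
by rewrite /p im; apply/asboolP.
Qed.

(** A correct test makes [touched] the true vector after the position, which determines the vector
    at the class successor. Correctness thus spreads from the zero vector at the first occurrence to
    the last one, and from there to the end of the word. *)
Lemma class_rulesE u : class_rules u <->
  (forall i x, onth u i = Some x -> test x.1 = Some (zrun x.2 zero (take i u))) /\
  (forall d, zok (zrun d zero u)).
Proof.
have unseen d i : i <= size u -> (forall k y, k < i -> onth u k = Some y -> y.2 <> d) ->
    zrun d zero (take i u) = zero.
  move=> ui nd; rewrite zrun_unseen ?foldl_move_zero //; apply/all_takeP => // k ki.
  have : k < size u by apply: leq_trans ki ui.
  rewrite -onthTE; case uk : (onth u k) => [y|] //= _.
  by apply/asboolPn; apply: nd uk.
have touchedE i x : onth u i = Some x ->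
    test x.1 = Some (zrun x.2 zero (take i u)) ->
    touched x.1 = touch x.1 (zrun x.2 zero (take i u)).
  by rewrite /touched => _ ->.
have succE i j x y : onth u i = Some x -> onth u j = Some y ->
    class_succ (word u) i j ->
    zrun y.2 zero (take j u) =
    foldl move (touch x.1 (zrun x.2 zero (take i u))) (map fst (between u i j)).
  move=> ui uj [ij /same_dataP[x' [y' [+ + xy]]] nk].
  rewrite ui uj => -[xx'] [yy']; rewrite -xx' -yy' in xy.
  rewrite -xy; apply: zrun_between => //.
  by apply: class_succ_unseen nk => //; apply/ltnW/onth_lt/uj.
have lastE i x : onth u i = Some x -> ~ (exists k, class_succ (word u) i k) ->
    zrun x.2 zero u = foldl move (touch x.1 (zrun x.2 zero (take i u)))
                        (map fst (between u i (size u))).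
  move=> ui nsucc; rewrite -{1}(take_size u).
  apply: zrun_between => //; first exact: onth_lt ui.
  exact: class_succ_unseen (class_succ_last ui nsucc).
split=> [[rZ rL rE]|[tu ok]]; last first.
  split=> [i x ui npred|i j x y ui uj sij|i x ui nsucc].
  - rewrite (tu i) // unseen //; first exact/ltnW/onth_lt/ui.
    by move=> k y ki uk yx; apply: npred; apply: class_pred_ex uk ui _ ki.
  - by rewrite (tu j y uj) (succE i j x y) // (touchedE i x ui (tu i x ui)).
  - by rewrite (touchedE i x ui (tu i x ui)) -(lastE i x).
have tu i x : onth u i = Some x -> test x.1 = Some (zrun x.2 zero (take i u)).
  (* Strong induction, as the class predecessor may lie far to the left. *)
  elim/ltn_ind: i x => j IH y uj.
  have [[i sij]|npred] := pselect (exists i, class_succ (word u) i j); last first.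
    rewrite (rZ j) // unseen //; first exact/ltnW/onth_lt/uj.
    by move=> k x kj uk xy; apply: npred; apply: class_pred_ex uk uj _ kj.
  have [ij /same_dataP[x [_ [ui _ _]]] _] := sij.
  by rewrite (rL i j x y) // (succE i j x y) // (touchedE i x ui (IH i ij x ui)).
split=> // d.
have [[i0 [x0 [ui0 x0d]]]|nd] := pselect (exists i x, onth u i = Some x /\ x.2 = d); last first.
  (* A datum that does not occur keeps the zero vector. *)
  rewrite -{1}(take_size u) unseen ?/zok ?eqxx // => k y _ uk yd.
  by apply: nd; exists k, y.
(* The largest position satisfying [p] is the last occurrence of [d], where the final rule
   applies. *)
pose p i := `[< exists x, onth u i = Some x /\ x.2 = d >].
have pex : exists i, p i by exists i0; apply/asboolP; exists x0.
have pub i : p i -> i <= size u by move=> /asboolP[x [ui _]]; apply/ltnW/onth_lt/ui.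
case: (ex_maxnP pex pub) => i /asboolP[x [ui xd]] imax.
have nsucc : ~ exists k, class_succ (word u) i k.
  move=> [k [ik /same_dataP[x' [y [+ uk x'y]]] _]]; rewrite ui => -[xx'].
  suff /imax : p k by rewrite leqNgt ik.
  by apply/asboolP; exists y; split=> //; rewrite -x'y -xx'.
by rewrite -xd (lastE i x) // -(touchedE i x ui (tu i x ui)); apply: rE.
Qed.

Lemma path_onthP T (e : rel T) a s : path e a s <->
  forall i b c, onth (a :: s) i = Some b -> onth (a :: s) i.+1 = Some c -> e b c.
Proof.
elim: s a => [|a' s IH] a /=.
  by split=> // _ [|[|i]].
split=> [/andP[aa' /IH p] [|i] b c|p].
- by move=> [<-] [<-].
- exact: p.
by apply/andP; split; [apply: (p 0)|apply/IH => i b c; apply: (p i.+1)].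
Qed.

Lemma onth_last T (a : T) s : onth (a :: s) (size s) = Some (last a s).
Proof. by elim: s a => //= a' s IH a; rewrite -IH. Qed.

Lemma between_rcons T (s : seq T) i j y : onth s j = Some y -> i < j ->
  between s i j.+1 = rcons (between s i j) y.
Proof.
rewrite /between; elim: s i j => [|a s IH] [|i] [|j] //=; last first.
  by rewrite ltnS; apply: IH.
rewrite !drop0 => + _; elim: s j {IH} => [|b s IH] [|j] //=; first by rewrite take0 => -[->].
by move=> /IH ->.
Qed.

Lemma map_between T T' (f : T -> T') s i j :
  between (map f s) i j = map f (between s i j).
Proof. by rewrite /between -map_take -map_drop. Qed.

(** * The same conditions as rules on pairs of positions *)

Definition init g : bool := oapp (mem (sa_init A)) false (src g).

(** The shape follows [FRules], so that the two unfold to the same proposition. A regular predicate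
    sees only the factor strictly between two positions; so the final check takes the last position
    as [j] and applies its letter [g'] separately, while [i = j] covers an occurrence at the last
    position. *)
Definition rules u i j g g' : Prop :=
  let class_succ_at k l := class_succ (word u) k l in
  let N := size (word u) in
  valid g /\
  (succ_pos (word u) i j -> tgt g == src g') /\
  (~ (exists2 k, k < N & k < i) -> init g) /\
  (~ (exists2 k, k < N & i < k) -> fin g) /\
  (~ (exists2 k, k < N & class_succ_at k i) -> test g == Some zero) /\
  (class_succ_at i j -> i < j /\
     test g' == Some (foldl move (touched g) (between (map fst u) i j))) /\
  (~ (exists2 k, k < N & class_succ_at i k) -> ~ (exists2 k, k < N & j < k) ->
     (i = j -> zok (touched g)) /\
     (i < j -> i < j /\
        zok (move (foldl move (touched g) (between (map fst u) i j)) g'))).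

(** Pairs of positions say nothing about the empty word, whose acceptance is therefore a separate
    clause. *)
Lemma rulesE u :
  (forall i j x y, onth u i = Some x -> onth u j = Some y -> rules u i j x.1 y.1) /\
  (u = [::] -> [exists q, (q \in sa_init A) && (q \in sa_final A)]) <->
  (exists2 q, q \in sa_init A & chain q (map fst u)) /\ class_rules u.
Proof.
have szw : size (word u) = size u by rewrite size_map.
have succ_lt k l : class_succ (word u) k l -> k < size u /\ l < size u.
  by move=> [_ /same_dataP[x [y [uk ul _]]] _]; rewrite (onth_lt uk) (onth_lt ul).
have map_onth i g : onth (map fst u) i = Some g -> exists2 x, onth u i = Some x & x.1 = g.
  by rewrite onth_map; case: (onth u i) => //= x [<-]; exists x.
split.
- move=> [ruleu u0]; split; last first.
    split=> [i x ui npred|i j x y ui uj sij|i x ui nsucc].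
    + have [_ [_ [_ [_ [r _]]]]] := ruleu i i x x ui ui.
      by apply/eqP/r; case=> k _ ski; apply: npred; exists k.
    + have [_ [_ [_ [_ [_ [r _]]]]]] := ruleu i j x y ui uj.
      by have [_ /eqP] := r sij; rewrite map_between.
    + have ltiu := onth_lt ui.
      (* The last position serves as [j]; if [i < j], the factor up to the end is the one strictly
         between [i] and [j] followed by the letter at [j]. *)
      have: (size u).-1 < size u by rewrite prednK // (leq_ltn_trans _ ltiu).
      rewrite -onthTE; case uj: (onth u (size u).-1) => [y|] // _.
      have [_ [_ [_ [_ [_ [_ r]]]]]] := ruleu i _ x y ui uj.
      have [||req rlt] := r.
      * by case=> k _ sik; apply: nsucc; exists k.
      * by case=> k; rewrite szw => ku; rewrite ltnNge -ltnS prednK ?ku // (leq_ltn_trans _ ltiu).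
      have szE : size u = (size u).-1.+1 by rewrite prednK // (leq_ltn_trans _ ltiu).
      have := ltiu; rewrite {1}szE ltnS leq_eqVlt => /orP[/eqP e|lt].
        rewrite (_ : between u i (size u) = [::]); first exact: req.
        by rewrite /between take_size drop_oversize // {1}szE e.
      rewrite szE (between_rcons uj lt) map_rcons foldl_rcons.
      by have [_] := rlt lt; rewrite map_between.
  case: u ruleu u0 {szw succ_lt} map_onth => [|x u] ruleu u0 map_onth.
    by have /existsP[q /andP[qI qF]] := u0 erefl; exists q.
  have [_ [_ [r _]]] := ruleu 0 0 x x erefl erefl.
  have : init x.1 by apply: r; case=> k _; rewrite ltn0.
  rewrite /init; case sx: (src x.1) => [q|] //= qI; exists q => //=.
  rewrite sx eqxx /=; apply/and3P; split.
  + apply/(@allP _ _ (map fst (x :: u))) => g /onthP[i /map_onth[y uy <-]].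
    by have [] := ruleu i i y y uy uy.
  + apply/path_onthP => i b c /map_onth[y uy <-] /map_onth[y' uy' <-].
    have [_ [rs _]] := ruleu i i.+1 y y' uy uy'.
    by apply: rs; split=> //; have := onth_lt uy'; rewrite size_map.
  + have /map_onth[y uy <-] := onth_last x.1 (map fst u).
    have [_ [_ [_ [rf _]]]] := ruleu _ _ y y uy uy.
    by apply: rf; case=> k; rewrite !size_map /= ltnS => /leq_gtF ->.
- move=> [[q qI cu] [rZ rL rE]]; split; last first.
    by move=> u0; move: cu; rewrite u0 /= => qF; apply/existsP; exists q; rewrite qI.
  have chainP : [/\ forall i x, onth u i = Some x -> valid x.1,
     forall x, onth u 0 = Some x -> init x.1,
     forall i x y, onth u i = Some x -> onth u i.+1 = Some y -> tgt x.1 == src y.1 &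
     forall i x, onth u i = Some x -> i.+1 = size u -> fin x.1].
    case: u cu {szw succ_lt map_onth rZ rL rE} => [|x0 u] /=; first by split=> [[]|||[]].
    case/and4P=> /eqP sx0 vu pu fu.
    have mo i x : onth (x0 :: u) i = Some x -> onth (x0.1 :: map fst u) i = Some x.1.
      by move=> ui; rewrite (onth_map i (x0 :: u) fst) ui.
    split.
    + by move=> i x /mo ui; apply: (@allP _ valid (x0.1 :: map fst u) vu); apply/onthP; exists i.
    + by move=> x [<-]; rewrite /init sx0.
    + move=> i x y ui uy; have /path_onthP pP := pu.
      exact: pP (mo i x ui) (mo i.+1 y uy).
    + move=> i x /mo ui [iu]; move: fu; have := onth_last x0.1 (map fst u).
      by rewrite size_map -iu ui => -[->].
  case: chainP => cv ci cs cf i j x y ui uj.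
  split; first exact: cv ui.
  split; first by case=> _ ji; apply: (cs i); rewrite // -ji.
  split.
    have := ui; case: (i) => [|k] uk; first by move=> _; apply: ci.
    by case; exists 0; rewrite // szw (leq_ltn_trans _ (onth_lt uk)).
  split.
    move=> nlast; apply: (cf i x ui); apply/eqP; rewrite eqn_leq (onth_lt ui) /= leqNgt.
    by apply/negP => iu; apply: nlast; exists i.+1; rewrite ?szw.
  split.
    move=> npred; rewrite (rZ i x ui) // => -[k ski]; apply: npred; exists k => //.
    by rewrite szw; have [] := succ_lt _ _ ski.
  split.
    move=> sij; split; first by case: sij.
    by rewrite (rL i j x y ui uj sij) map_between.
  move=> nsucc nlast.
  have juE : size u = j.+1.
    apply/eqP; rewrite eqn_leq (onth_lt uj) andbT leqNgt.
    by apply/negP => ju; apply: nlast; exists j.+1; rewrite ?szw.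
  have ok : zok (foldl move (touched x.1) (map fst (between u i (size u)))).
    apply: rE => // -[k sik]; apply: nsucc; exists k => //.
    by rewrite szw; have [] := succ_lt _ _ sik.
  split=> [ij|ij].
    by move: ok; rewrite /between take_size drop_oversize // juE ij.
  split=> //; move: ok.
  by rewrite juE (between_rcons uj ij) map_rcons foldl_rcons map_between.
Qed.

(** * The formula describing accepting runs *)

(** There are finitely many vectors, so [move] is the transition function of a finite automaton. *)
Lemma regular_foldl (z : Z) (p : pred Z) :
  regular (fun s : seq G => p (foldl move z s)).
Proof.
by exists (DFA z move [set z' | p z']%SET) => s; rewrite /dfa_accepts /= inE.
Qed.

Local Notation fo := (fo2 Sigma n).

Definition FBool (b : bool) : fo :=
  if b then @FEq Sigma n vx vx else FNot (@FEq Sigma n vx vx).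
Definition FImp (f h : fo) : fo := FOr (FNot f) h.
Definition FOrs (I : finType) (f : I -> fo) : fo :=
  foldr (fun i h => FOr (f i) h) (FBool false) (enum I).
Definition FAnds (I : finType) (f : I -> fo) : fo :=
  foldr (fun i h => FAnd (f i) h) (FBool true) (enum I).

Definition FIs g t : fo :=
  FAnd (@FLetter Sigma n g.1 t)
    (FAnds (fun k => if k \in g.2 then @FSet Sigma n k t else FNot (@FSet Sigma n k t))).

Definition FLast t : fo :=
  FNot (FEx (if t is vx then vy else vx)
          (@FLt Sigma n t (if t is vx then vy else vx))).

(** For fixed letters all facts about transitions are Boolean constants; only order and class
    structure remain to be expressed. *)
Definition FRules g g' : fo :=
  FAnd (FBool (valid g))
  (FAnd (FImp (@FSucc Sigma n vx vy) (FBool (tgt g == src g')))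
  (FAnd (FImp (FNot (FEx vy (@FLt Sigma n vy vx))) (FBool (init g)))
  (FAnd (FImp (FLast vx) (FBool (fin g)))
  (FAnd (FImp (FNot (FEx vy (@FClassSucc Sigma n vy vx)))
           (FBool (test g == Some zero)))
  (FAnd (FImp (@FClassSucc Sigma n vx vy)
           (FReg (regular_foldl (touched g) (fun z => test g' == Some z)) vx vy))
        (FImp (FNot (FEx vy (@FClassSucc Sigma n vx vy))) (FImp (FLast vy)
           (FAnd (FImp (@FEq Sigma n vx vy) (FBool (zok (touched g))))
                 (FImp (@FLt Sigma n vx vy)
                    (FReg (regular_foldl (touched g) (fun z => zok (move z g')))
                       vx vy)))))))))).

(** The disjunction over pairs of letters determines the labels at [x] and [y], which [FRules] then
    takes as constants. The second conjunct excludes the empty word unless some initial state is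
    final. *)
Definition FRun : fo :=
  FAnd (FAll vx (FAll vy (FOrs (fun c : G * G =>
          FAnd (FIs c.1 vx) (FAnd (FIs c.2 vy) (FRules c.1 c.2))))))
    (if [exists q, (q \in sa_init A) && (q \in sa_final A)]
     then FAll vx (@FEq Sigma n vx vx) else FEx vx (@FEq Sigma n vx vx)).

Lemma FRun_closed t : ~~ free FRun t.
Proof. by rewrite /FRun /=; case: ifP => _; case: t. Qed.

Section Satisfaction.
Variable u : seq (G * D).
Local Notation sat := (sat (word u) (ext_sets u)).

Lemma sat_bool e b : sat e (FBool b) = b.
Proof. by apply/propext; case: b => /=; split=> // /(_ erefl). Qed.

Lemma sat_ors e (I : finType) (f : I -> fo) :
  sat e (FOrs f) <-> exists i, sat e (f i).
Proof.
suff : sat e (FOrs f) <-> exists2 i, i \in enum I & sat e (f i).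
  by move=> ->; split=> [[i _ fi]|[i fi]]; exists i => //; rewrite mem_enum.
rewrite /FOrs; elim: (enum I) => [|i s IH].
  by rewrite /=; split=> [/(_ erefl)|[]].
rewrite /= IH; split=> [[fi|[k ks fk]]|[k]].
- by exists i => //; rewrite mem_head.
- by exists k => //; rewrite inE ks orbT.
- by rewrite inE => /predU1P[->|ks] fk; [left|right; exists k].
Qed.

Lemma sat_ands e (I : finType) (f : I -> fo) :
  sat e (FAnds f) <-> forall i, sat e (f i).
Proof.
suff : sat e (FAnds f) <-> forall i, i \in enum I -> sat e (f i).
  by move=> ->; split=> fi i; [apply: fi; rewrite mem_enum|].
rewrite /FAnds; elim: (enum I) => [|i s IH].
  by split.
rewrite /= IH; split=> [[fi fs] k|fs].
  by rewrite inE => /predU1P[->|/fs].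
by split=> [|k ks]; apply: fs; rewrite inE ?eqxx ?ks ?orbT.
Qed.

Lemma sat_is e t g x : onth u (e t) = Some x -> sat e (FIs g t) <-> x.1 = g.
Proof.
move=> ux; rewrite /= sat_ands /has_letter onth_map ux /=.
have setE k : ext_sets u k (e t) <-> k \in x.1.2 by rewrite /ext_sets ux.
split=> [[[d [xg _]] xk]|<-].
  rewrite [x.1]surjective_pairing [RHS]surjective_pairing xg; congr pair.
  apply/setP => k; have := xk k; case: ifP => _ /=; first by move/setE.
  by move=> nk; apply/negP => /setE.
by split=> [|k]; [exists x.2|case: ifP => kx /=; rewrite setE kx].
Qed.

Lemma sat_rules i j g g' : sat (env i j) (FRules g g') = rules u i j g g'.
Proof.
rewrite /rules /= !orNp !sat_bool ext_word_ext_sets.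
by [].
Qed.

Lemma sat_run : sat (fun=> 0) FRun <->
  (forall i j x y, onth u i = Some x -> onth u j = Some y -> rules u i j x.1 y.1) /\
  (u = [::] -> [exists q, (q \in sa_init A) && (q \in sa_final A)]).
Proof.
have envE i j : update (update (fun=> 0) vx i) vy j = env i j by apply/funext => -[].
rewrite [FRun]lock /= -lock /FRun; split=> -[ru u0]; split.
- move=> i j x y ui uj.
  have := ru i; rewrite size_map => /(_ (onth_lt ui) j (onth_lt uj)).
  rewrite envE => /sat_ors[[g g'] /= [/(@sat_is (env i j) vx g x ui) <-]].
  by move=> [/(@sat_is (env i j) vy g' y uj) <-]; rewrite -sat_rules.
- by move=> uE; case: ifP u0 => // _ [i]; rewrite uE.
- move=> i; rewrite size_map => iu j; rewrite size_map envE => ju.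
  move: iu ju; rewrite -!onthTE; case ui: (onth u i) => [x|//] _.
  case uj: (onth u j) => [y|//] _; apply/sat_ors; exists (x.1, y.1).
  split; first exact/(@sat_is (env i j) vx x.1 x ui).
  split; first exact/(@sat_is (env i j) vy y.1 y uj).
  by rewrite sat_rules; apply: ru.
- case: ifP => [_ //|nq]; exists 0 => //; rewrite size_map.
  by case: (u) u0 => // /(_ erefl); rewrite nq.
Qed.

End Satisfaction.

Definition run_formula : emso2 Sigma := EMSO2 FRun_closed.

Lemma run_formulaE : sa_language A = emso2_language run_formula :> data_language Sigma D.
Proof.
have goodE u : sat (word u) (ext_sets u) (fun=> 0) FRun <->
    exists2 q, q \in sa_init A & good_run q (fun=> zero) u.
  rewrite sat_run rulesE class_rulesE; split=> [[[q qI cu] [tu ok]]|[q qI]].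
    by exists q => //; apply/good_runE.
  by move=> /good_runE[cu tu ok]; split; [exists q|].
(* All sets are empty at the start, so every datum has the zero vector. *)
have char0 : char_vec (fun _ : Y => @set0 D) = (fun=> zero).
  by apply/funext => d; apply/char_vec_eq0 => -[].
apply/seteqP; split=> w /=.
- move=> [[q X] [c' [[/= qI X0] rw ac]]].
  have XE : X = fun=> set0 by apply/funext.
  have [u uw gr] := (sa_run_good w (q, X)).1 (ex_intro2 _ _ c' rw ac).
  exists (ext_sets u); split.
    move=> k i; rewrite -uw /= size_map -onthTE /ext_sets.
    by case: (onth u i).
  by rewrite -uw; apply/goodE; exists q => //; rewrite -char0 -XE.
- move=> [X [/ext_sets_ex[u uw <-]]]; rewrite -{1}uw => /goodE[q qI gr].
  rewrite -char0 in gr.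
  have [c' rw ac] := (sa_run_good w (q, fun=> set0)).2 (ex_intro2 _ _ u uw gr).
  by exists (q, fun=> set0), c'; split.
Qed.

End SetAutomataToFormulas.

Theorem theorem43 (D : Type) (infD : infinite_set [set: D]) (Sigma : finType)
    (L : data_language Sigma D) :
  (exists A : set_automaton Sigma, L = sa_language A) <->
  (exists phi : emso2 Sigma, L = emso2_language phi).
Proof.
split=> [[A ->]|[phi ->]].
  by exists (run_formula A); apply: run_formulaE.
have [B [f [A ->]]] := emso2_class_language D phi.
by exists (class_set_automaton f A); rewrite class_set_automatonE.
Qed.
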